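(* Let $\varphi:\mathbb{R}^n\to\mathbb{R}$ be of class $\mathcal{C}^{1,1}$ and let $x^0\in\mathbb{R}^n$ be such that, with $\Omega:=\{x\in\mathbb{R}^n\mid \varphi(x)\le\varphi(x^0)\}$: (1) for every $x\in\Omega$ the mapping $\partial^2\varphi(x)$ is positive-definite, i.e. $\langle z,u\rangle>0$ for all $u\neq 0$ and all $z\in\partial^2\varphi(x)(u)$; (2) $\Omega$ is bounded. Then every sequence $\{x^k\}$ generated by the Generalized Damped Newton Algorithm (with parameters $\sigma\in(0,\tfrac12)$, $\beta\in(0,1)$) from the starting point $x^0$ is convergent, and its limit is a tilt-stable local minimizer of $\varphi$.
   Context: A function $\varphi:\mathbb{R}^n\to\mathbb{R}$ is of class $\mathcal{C}^{1,1}$ if it is continuously differentiable and $\nabla\varphi$ is Lipschitz continuous around every point. For $\Omega\subset\mathbb{R}^s$ and $\bar z\in\Omega$, the regular normal cone is $\widehat N_\Omega(\bar z):=\{v\mid \limsup_{z\to\bar z,\,z\in\Omega}\langle v,z-\bar z\rangle/\|z-\bar z\|\le 0\}$ and the limiting normal cone $N_\Omega(\bar z)$ is the set of all $v$ for which there exist $z_k\to\bar z$ with $z_k\in\Omega$ and $v_k\to v$ with $v_k\in\widehat N_\Omega(z_k)$. For a set-valued map $F:\mathbb{R}^n\rightrightarrows\mathbb{R}^m$ and $(\bar x,\bar y)\in\operatorname{gph}F$, the coderivative is $D^*F(\bar x,\bar y)(v):=\{u\mid (u,-v)\in N_{\operatorname{gph}F}(\bar x,\bar y)\}$. For $\varphi$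 of class $\mathcal{C}^{1,1}$, the second-order subdifferential (generalized Hessian) is $\partial^2\varphi(x)(u):=D^*(\nabla\varphi)(x,\nabla\varphi(x))(u)$, $u\in\mathbb{R}^n$. A point $\bar x$ is a tilt-stable local minimizer of $\varphi$ if there is $\gamma>0$ such that the map $M_\gamma(v):=\operatorname{argmin}\{\varphi(x)-\langle v,x\rangle\mid x\in\mathbb{B}_\gamma(\bar x)\}$ is single-valued and Lipschitz continuous on a neighborhood of $0$ with $M_\gamma(0)=\{\bar x\}$. Generalized Damped Newton Algorithm: given $\sigma\in(0,\tfrac12)$, $\beta\in(0,1)$ and $x^0$, set $k=0$. If $\nabla\varphi(x^k)=0$ stop. Otherwise choose $d^k$ with $-\nabla\varphi(x^k)\in\partial^2\varphi(x^k)(d^k)$; set $\tau_k=1$ and, while $\varphi(x^k+\tau_kd^k)>\varphi(x^k)+\sigma\tau_k\langle\nabla\varphi(x^k),d^k\rangle$, replace $\tau_k$ by $\beta\tau_k$; set $x^{k+1}:=x^k+\tau_kd^k$, increase $k$ by 1 and repeat. *)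

(* Defs.v *)
From HB Require Import structures.
From mathcomp Require Import all_boot all_order all_algebra.
From mathcomp Require Import reals.
Set Implicit Arguments. Unset Strict Implicit. Unset Printing Implicit Defensive.
Import Order.TTheory GRing.Theory Num.Theory.
Local Open Scope ring_scope.

Section Defs.
Variable R : realType.

Definition dot {s : nat} (u v : 'rV[R]_s) : R := \sum_(i < s) u 0 i * v 0 i.
Definition enorm {s : nat} (u : 'rV[R]_s) : R := Num.sqrt (dot u u).

Definition seq_cvg {s : nat} (z : nat -> 'rV[R]_s) (l : 'rV[R]_s) : Prop :=
  forall eps : R, 0 < eps -> exists N : nat, forall k, (N <= k)%N -> enorm (z k - l) < eps.

Definition is_gradient {n : nat} (f : 'rV[R]_n -> R) (x g : 'rV[R]_n) : Prop :=
  forall eps : R, 0 < eps -> exists delta : R, 0 < delta /\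
    forall y, enorm (y - x) < delta ->
      `|f y - f x - dot g (y - x)| <= eps * enorm (y - x).

Definition C11 {n : nat} (phi : 'rV[R]_n -> R) (grad : 'rV[R]_n -> 'rV[R]_n) : Prop :=
  (forall x, is_gradient phi x (grad x)) /\
  (forall x, exists r : R, 0 < r /\ exists L : R,
      forall y z, enorm (y - x) < r -> enorm (z - x) < r ->
        enorm (grad y - grad z) <= L * enorm (y - z)).

(* regular normal cone: limsup_{z ->_Omega zb} <v, z - zb>/|z - zb| <= 0 *)
Definition regular_normal {s : nat} (Omega : 'rV[R]_s -> Prop) (zb v : 'rV[R]_s) : Prop :=
  forall eps : R, 0 < eps -> exists delta : R, 0 < delta /\
    forall z, Omega z -> enorm (z - zb) < delta ->
      dot v (z - zb) <= eps * enorm (z - zb).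

Definition limiting_normal {s : nat} (Omega : 'rV[R]_s -> Prop) (zb v : 'rV[R]_s) : Prop :=
  exists (zk vk : nat -> 'rV[R]_s),
    (forall k, Omega (zk k)) /\ (forall k, regular_normal Omega (zk k) (vk k)) /\
    seq_cvg zk zb /\ seq_cvg vk v.

Definition graph {n m : nat} (F : 'rV[R]_n -> 'rV[R]_m) : 'rV[R]_(n + m) -> Prop :=
  fun w => exists x, w = row_mx x (F x).

Definition coderiv {n m : nat} (F : 'rV[R]_n -> 'rV[R]_m) (x : 'rV[R]_n) (y v : 'rV[R]_m)
  (u : 'rV[R]_n) : Prop :=
  limiting_normal (graph F) (row_mx x y) (row_mx u (- v)).

Definition hess2 {n : nat} (grad : 'rV[R]_n -> 'rV[R]_n) (x u z : 'rV[R]_n) : Prop :=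
  coderiv grad x (grad x) u z.

Definition tilt_argmin {n : nat} (phi : 'rV[R]_n -> R) (gamma : R) (xb v x : 'rV[R]_n) : Prop :=
  enorm (x - xb) <= gamma /\
  forall y, enorm (y - xb) <= gamma -> phi x - dot v x <= phi y - dot v y.

Definition tilt_stable {n : nat} (phi : 'rV[R]_n -> R) (xb : 'rV[R]_n) : Prop :=
  exists gamma : R, 0 < gamma /\
  exists delta : R, 0 < delta /\
  exists (M : 'rV[R]_n -> 'rV[R]_n) (L : R),
    (forall v, enorm v < delta -> forall x, tilt_argmin phi gamma xb v x <-> x = M v) /\
    (forall v w, enorm v < delta -> enorm w < delta ->
        enorm (M v - M w) <= L * enorm (v - w)) /\
    M 0 = xb.

(* one step of the Generalized Damped Newton Algorithm: from xk to xk1.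
   If grad xk = 0 the algorithm stops; we encode the stopped sequence by
   repeating the final iterate forever. Otherwise a direction d with
   -grad xk \in d^2 phi(xk)(d) is chosen and tau = beta^j where j is the
   number of backtracking steps (first j with the Armijo condition). *)
Definition gdn_step {n : nat} (phi : 'rV[R]_n -> R) (grad : 'rV[R]_n -> 'rV[R]_n)
  (sigma beta : R) (xk xk1 : 'rV[R]_n) : Prop :=
  if grad xk == 0 then xk1 = xk else
  exists d : 'rV[R]_n, hess2 grad xk d (- grad xk) /\
  exists j : nat,
    (forall i, (i < j)%N ->
       phi (xk + beta ^+ i *: d) > phi xk + sigma * beta ^+ i * dot (grad xk) d) /\
    phi (xk + beta ^+ j *: d) <= phi xk + sigma * beta ^+ j * dot (grad xk) d /\
    xk1 = xk + beta ^+ j *: d.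

Definition gdn_sequence {n : nat} (phi : 'rV[R]_n -> R) (grad : 'rV[R]_n -> 'rV[R]_n)
  (sigma beta : R) (x0 : 'rV[R]_n) (xs : nat -> 'rV[R]_n) : Prop :=
  xs 0%N = x0 /\ forall k, gdn_step phi grad sigma beta (xs k) (xs k.+1).

End Defs.

(* Main.v *)
Require Import Defs.
From HB Require Import structures.
From mathcomp Require Import all_boot all_order all_algebra.
From mathcomp Require Import reals.
From mathcomp Require Import boolp classical_sets topology normedtype sequences derive.
From mathcomp Require Import ring lra.
Set Implicit Arguments. Unset Strict Implicit. Unset Printing Implicit Defensive.
Import Order.TTheory GRing.Theory Num.Theory.
Import numFieldNormedType.Exports.
Local Open Scope classical_set_scope.
Local Open Scope ring_scope.

(** Positive definiteness of the limiting coderivative at a point [xb] of the level set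
    is robust: by compactness every regular normal [(z, -u)] to the graph of [grad] at a
    point near [xb] satisfies [<z, u> >= kappa |u|^2]. A mean value inequality for
    proximal subgradients of [<v, grad>] turns this into strong monotonicity of [grad],
    hence strong convexity of [phi], near [xb]; if [xb] is stationary, tilt stability
    follows.

    The iterates decrease [phi], so they stay in the bounded level set and have a cluster
    point [xb]. It is stationary, since otherwise the Armijo rule would lower [phi] by a
    fixed amount at every iterate near [xb], bringing it below [phi xb]. Strong convexity
    makes [phi - phi xb] a Lyapunov function that traps the iterates near [xb]. *)

(** * Euclidean inner product and norm, and compactness stated with this norm *)

Section EuclideanNorm.
Variables (R : realType) (n : nat).
Implicit Types (u v w x y : 'rV[R]_n) (a : R).

Lemma dotC u v : dot u v = dot v u.
Proof. by apply: eq_bigr => i _; rewrite mulrC. Qed.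

Lemma dotDl u v w : dot (u + v) w = dot u w + dot v w.
Proof. by rewrite /dot -big_split; apply: eq_bigr => i _; rewrite mxE mulrDl. Qed.

Lemma dotZl a u v : dot (a *: u) v = a * dot u v.
Proof. by rewrite /dot mulr_sumr; apply: eq_bigr => i _; rewrite mxE mulrA. Qed.

Lemma dotNl u v : dot (- u) v = - dot u v.
Proof. by rewrite -scaleN1r dotZl mulN1r. Qed.

Lemma dotBl u v w : dot (u - v) w = dot u w - dot v w.
Proof. by rewrite dotDl dotNl. Qed.

Lemma dotDr u v w : dot w (u + v) = dot w u + dot w v.
Proof. by rewrite dotC dotDl !(dotC w). Qed.

Lemma dotZr a u v : dot v (a *: u) = a * dot v u.
Proof. by rewrite dotC dotZl dotC. Qed.

Lemma dotNr u v : dot v (- u) = - dot v u.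
Proof. by rewrite dotC dotNl dotC. Qed.

Lemma dotBr u v w : dot w (u - v) = dot w u - dot w v.
Proof. by rewrite dotDr dotNr. Qed.

Definition dotE := (dotDl, dotDr, dotBl, dotBr, dotZl, dotZr, dotNl, dotNr).

Lemma dot_sqrD u v : dot (u + v) (u + v) = dot u u + 2 * dot u v + dot v v.
Proof. by rewrite !dotE (dotC v u); ring. Qed.

Lemma dot_ge0 u : 0 <= dot u u.
Proof. by apply: sumr_ge0 => i _; rewrite -expr2 sqr_ge0. Qed.

Lemma enorm_ge0 u : 0 <= enorm u.
Proof. exact: sqrtr_ge0. Qed.

Lemma sqr_enorm u : enorm u ^+ 2 = dot u u.
Proof. by rewrite sqr_sqrtr // dot_ge0. Qed.

Lemma dot0l u : dot 0 u = 0.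
Proof. by rewrite -(scale0r u) dotZl mul0r. Qed.

Lemma dot0r u : dot u 0 = 0.
Proof. by rewrite dotC dot0l. Qed.

Lemma enorm0 : enorm (0 : 'rV[R]_n) = 0.
Proof. by rewrite /enorm dot0l sqrtr0. Qed.

Lemma dot_eq0 u : (dot u u == 0) = (u == 0).
Proof.
apply/idP/idP => [|/eqP ->]; last by rewrite dot0l.
rewrite psumr_eq0 => [/allP u0|i _]; last by rewrite -expr2 sqr_ge0.
apply/eqP/rowP => i; rewrite mxE; apply/eqP.
by have := u0 i (mem_index_enum _); rewrite /= -expr2 sqrf_eq0.
Qed.

Lemma enorm_eq0 u : (enorm u == 0) = (u == 0).
Proof. by rewrite -dot_eq0 -sqr_enorm sqrf_eq0. Qed.

Lemma enorm_gt0 u : (0 < enorm u) = (u != 0).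
Proof. by rewrite lt0r enorm_ge0 andbT enorm_eq0. Qed.

Lemma enormZ a u : enorm (a *: u) = `|a| * enorm u.
Proof. by rewrite /enorm dotZl dotZr mulrA -expr2 sqrtrM ?sqr_ge0 // sqrtr_sqr. Qed.

Lemma enormN u : enorm (- u) = enorm u.
Proof. by rewrite -scaleN1r enormZ normrN1 mul1r. Qed.

Lemma enorm_distC u v : enorm (u - v) = enorm (v - u).
Proof. by rewrite -enormN opprB. Qed.

Lemma dot_le_enorm u v : dot u v <= enorm u * enorm v.
Proof.
have [->|u0] := eqVneq u 0; first by rewrite dot0l enorm0 mul0r.
have [->|v0] := eqVneq v 0; first by rewrite dot0r enorm0 mulr0.
have up : 0 < enorm u by rewrite enorm_gt0.
have vp : 0 < enorm v by rewrite enorm_gt0.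
have := dot_ge0 (enorm v *: u - enorm u *: v).
rewrite !dotE (dotC v u) -!sqr_enorm => h.
rewrite -(ler_pM2l (mulr_gt0 up vp)); nra.
Qed.

Lemma norm_dot_le u v : `|dot u v| <= enorm u * enorm v.
Proof.
rewrite ler_norml dot_le_enorm andbT lerNl -dotNl.
by rewrite (le_trans (dot_le_enorm _ _)) // enormN.
Qed.

Lemma ler_enorm u v : (enorm u <= enorm v) = (dot u u <= dot v v).
Proof. by rewrite ler_sqrt ?dot_ge0. Qed.

Lemma ler_enormD u v : enorm (u + v) <= enorm u + enorm v.
Proof.
rewrite -(ler_pXn2r (n := 2)) ?nnegrE ?addr_ge0 ?enorm_ge0 //.
rewrite sqr_enorm !dotE (dotC v u) -!sqr_enorm.
have := dot_le_enorm u v; nra.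
Qed.

Lemma ler_enormB u v : enorm (u - v) <= enorm u + enorm v.
Proof. by rewrite (le_trans (ler_enormD _ _)) // enormN. Qed.

Lemma ler_dist_enormD u v w : enorm (u - w) <= enorm (u - v) + enorm (v - w).
Proof. by have := ler_enormD (u - v) (v - w); rewrite addrA subrK. Qed.

Lemma coord_le_enorm u i : `|u 0 i| <= enorm u.
Proof.
rewrite -sqrtr_sqr ler_sqrt ?dot_ge0 // /dot (bigD1 i) //= -expr2 lerDl.
by apply: sumr_ge0 => j _; rewrite -expr2 sqr_ge0.
Qed.

Lemma enorm_le_coord u a : 0 <= a -> (forall i, `|u 0 i| <= a) ->
  enorm u <= n.+1%:R * a.
Proof.
move=> a0 ua; rewrite -(ler_pXn2r (n := 2)) ?nnegrE ?mulr_ge0 ?enorm_ge0 //.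
rewrite sqr_enorm exprMn; apply: (@le_trans _ _ (\sum_(i < n) a ^+ 2)).
  by apply: ler_sum => i _; rewrite -expr2 -(real_normK (num_real (u 0 i))) lerXn2r ?nnegrE.
rewrite sumr_const card_ord -[X in X <= _]mulr_natl ler_wpM2r ?sqr_ge0 //.
by rewrite -natrX ler_nat (leq_trans (leqnSn n)) // -[X in (X <= _)%N]expn1 leq_pexp2l.
Qed.

(** The topology on row vectors is the entrywise one; comparing the two norms makes topological
    results available for [enorm]. *)
Lemma nbhs_enormP x (A : set 'rV[R]_n) :
  nbhs x A <-> exists2 e : R, 0 < e & forall y, enorm (y - x) < e -> A y.
Proof.
split=> [/nbhs_ballP[e /= e0 xeA]|[e e0 xeA]].
  exists e => // y yx; apply: xeA; split=> // i j; rewrite (ord1 i).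
  apply: le_lt_trans yx; rewrite enorm_distC.
  by have := coord_le_enorm (x - y) j; rewrite !mxE.
(* Dividing by [n.+2] while the norm comparison costs [n.+1] makes the final bound strict. *)
apply/nbhs_ballP; exists (e / n.+2%:R); first by rewrite /= divr_gt0.
move=> y /= [_ xy]; apply: xeA; rewrite enorm_distC.
have e2 : 0 < e / n.+2%:R by rewrite divr_gt0.
apply: (@le_lt_trans _ _ (n.+1%:R * (e / n.+2%:R))).
  by apply: enorm_le_coord => [|i]; [|rewrite !mxE]; apply: ltW => //; exact: xy.
by rewrite mulrCA gtr_pMr // ltr_pdivrMr // mul1r ltr_nat.
Qed.


(** Heine-Borel: [A] is a closed subset of a cube, which is a product of compact segments. *)
Lemma enorm_compact (A : set 'rV[R]_n) (M : R) :
  (forall x, A x -> enorm x <= M) ->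
  (forall x, (forall e, 0 < e -> exists2 y, A y & enorm (y - x) < e) -> A x) ->
  compact A.
Proof.
move=> AM Acl.
have cM : compact [set v : 'rV[R]_n | forall i, `[- M, M]%classic (v ord0 i)].
  by apply: (@rV_compact _ _ (fun=> `[- M, M]%classic)) => _; exact: segment_compact.
apply: subclosed_compact cM _ => [x Ax|x Ax i /=].
  apply: Acl => e e0.
  have [|y [Ay yx]] := Ax [set y | enorm (y - x) < e]; last by exists y.
  by apply/nbhs_enormP; exists e.
by rewrite in_itv /= -ler_norml (le_trans (coord_le_enorm _ _)) // AM.
Qed.

(** Bolzano-Weierstrass, read off from a cluster point of the image filter in a closed ball. *)
Lemma enorm_cluster_point (x : nat -> 'rV[R]_n) (M : R) :
  (forall k, enorm (x k) <= M) ->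
  exists l, forall e, 0 < e -> forall N, exists2 k, (N <= k)%N & enorm (x k - l) < e.
Proof.
move=> xM.
have /(_ (x @ \oo)) : compact [set y : 'rV[R]_n | enorm y <= M].
  apply: (@enorm_compact _ M) => // y yM /=; rewrite leNgt; apply/negP => My.
  have [|z /= zM zy] := yM (enorm y - M); first by rewrite subr_gt0.
  have := ler_enormB z (z - y); rewrite subKr; lra.
case=> [|l [_ lc]]; first by exists 0%N => // k _; exact: xM.
exists l => e e0 N.
have [||y [[k Nk <-] kl]] := lc (x @` [set k | (N <= k)%N]) [set y | enorm (y - l) < e].
- by exists N => // k /= Nk; exists k.
- by apply/nbhs_enormP; exists e.
by exists k.
Qed.

Lemma enorm_EVT_min (A : set 'rV[R]_n) (f : 'rV[R]_n -> R) (M : R) :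
  A !=set0 -> (forall x, A x -> enorm x <= M) ->
  (forall x, (forall e, 0 < e -> exists2 y, A y & enorm (y - x) < e) -> A x) ->
  (forall x, A x -> forall e, 0 < e -> exists2 d, 0 < d &
     forall y, A y -> enorm (y - x) < d -> `|f y - f x| < e) ->
  exists2 x, A x & forall y, A y -> f x <= f y.
Proof.
move=> A0 AM Acl fc.
have [||x Ax xmin] := @EVT_min_rV _ _ f A A0.
- exact: enorm_compact AM Acl.
- apply/subspace_continuousP => x Ax; apply/cvgrPdist_lt => e e0.
  have [d d0 fd] := fc x Ax e e0; rewrite near_withinE.
  by apply/nbhs_enormP; exists d => // y yx Ay; rewrite distrC fd.
exists x; first exact: set_mem.
by move=> y Ay; apply: xmin; exact: mem_set.
Qed.

(** Exchanging [x] and [y] makes the one-sided bound two-sided, so [f] is continuous on the compact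
    set [A]. *)
Lemma lipschitz_EVT_min (A : set 'rV[R]_n) (f : 'rV[R]_n -> R) (M C : R) :
  A !=set0 -> (forall x, A x -> enorm x <= M) ->
  (forall x, (forall e, 0 < e -> exists2 y, A y & enorm (y - x) < e) -> A x) ->
  (forall x y, A x -> A y -> f y - f x <= C * enorm (y - x)) ->
  exists2 x, A x & forall y, A y -> f x <= f y.
Proof.
move=> A0 AM Acl fC; apply: enorm_EVT_min A0 AM Acl _ => x Ax e e0.
have C0 : 0 < `|C| + 1 by rewrite ltr_wpDl.
exists (e / (`|C| + 1)) => [|y Ay]; first exact: divr_gt0.
rewrite ltr_pdivlMr // => yx; apply: le_lt_trans yx.
have le : C * enorm (y - x) <= enorm (y - x) * (`|C| + 1).
  by rewrite mulrC ler_wpM2l ?enorm_ge0 // ler_wpDr // ler_norm.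
rewrite ler_norml; have := fC _ _ Ax Ay; have := fC _ _ Ay Ax.
rewrite (enorm_distC x y); lra.
Qed.

Lemma seq_cvg_coord (z : nat -> 'rV[R]_n) l i :
  seq_cvg z l -> z k 0 i @[k --> \oo] --> l 0 i.
Proof.
move=> zl; apply/cvgrPdist_lt => e e0; have [N zN] := zl e e0.
near=> k; rewrite distrC; apply: le_lt_trans (zN k _).
  by have := coord_le_enorm (z k - l) i; rewrite !mxE.
by near: k; exists N.
Unshelve. all: by end_near.
Qed.

Lemma cvg_dot (z w : nat -> 'rV[R]_n) l m :
  seq_cvg z l -> seq_cvg w m -> dot (z k) (w k) @[k --> \oo] --> dot l m.
Proof.
move=> zl wm; rewrite /dot; apply: (@cvg_big R^o).
  exact: (@add_continuous R^o).
by move=> i _; apply: cvgM; exact: seq_cvg_coord.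
Qed.

End EuclideanNorm.

(** * Mean value theorem along a segment *)

Section MeanValue.
Variables (R : realType) (n : nat).

(** The one-variable theorem applied on the segment from [x] to [y]; the chain rule is checked
    directly from the expansion in [is_gradient]. *)
Lemma gradient_mean_value (phi : 'rV[R]_n -> R) grad x y :
  (forall z, is_gradient phi z (grad z)) ->
  exists2 t : R, 0 < t < 1 & phi y - phi x = dot (grad (x + t *: (y - x))) (y - x).
Proof.
move=> gphi; pose f (t : R) := phi (x + t *: (y - x)).
pose df (t : R) := dot (grad (x + t *: (y - x))) (y - x).
have fd (t : R) : is_derive t (1 : R) f (df t).
  have cf : h^-1 *: ((f \o shift t) (h *: (1:R)) - f t) @[h --> 0^'] --> df t.
    apply/cvgrPdist_lt => e e0; rewrite near_withinE.
    have D0 : 0 < enorm (y - x) + 1 by have := enorm_ge0 (y - x); lra.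
    (* The added 1 keeps the denominator positive when [y = x]. *)
    have [|d [d0 hd]] := gphi (x + t *: (y - x)) (e / 2 / (enorm (y - x) + 1)).
      by rewrite !divr_gt0.
    near=> h => h0; rewrite /= /f /df.
    set p := x + t *: (y - x) in hd *.
    have hn : 0 < `|h| by rewrite normr_gt0.
    have -> : x + (h *: 1 + t) *: (y - x) = p + h *: (y - x).
      by rewrite scalerDl /p [h *: 1]mulr1 addrAC addrA.
    have := hd (p + h *: (y - x)); rewrite [p + _]addrC addrK enormZ dotZr => /(_ _) hd'.
    have {}hd' : `|phi (h *: (y - x) + p) - phi p - h * dot (grad p) (y - x)| <=
       e / 2 / (enorm (y - x) + 1) * (`|h| * enorm (y - x)).
      apply: hd'; apply: (@le_lt_trans _ _ (`|h| * (enorm (y - x) + 1))).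
        by rewrite ler_wpM2l // lerDl.
      rewrite -ltr_pdivlMr //; near: h; apply: (@nbhs0_lt R R^o); exact: divr_gt0.
    set Q := phi _ - phi p in hd' *.
    have -> : dot (grad p) (y - x) - h^-1 *: Q = - (h^-1 * (Q - h * dot (grad p) (y - x))).
      by rewrite mulrBr mulKf // opprB.
    rewrite normrN normrM normfV mulrC ltr_pdivrMr //.
    apply: le_lt_trans hd' _.
    rewrite mulrCA [X in _ < X]mulrC ltr_pM2l // mulrAC ltr_pdivrMr //.
    have := enorm_ge0 (y - x); nra.
  apply: DeriveDef; first by apply/cvg_ex; exists (df t).
  exact: cvg_lim cf.
have [|c cin] := @MVT R f df 0 1 ltr01.
  by apply: derivable_within_continuous => t _; have [] := fd t.
rewrite /f scale1r scale0r addr0 subrKC subr0 mulr1 => ->.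
by exists c => //; move: cin; rewrite in_itv.
Unshelve. all: by end_near.
Qed.

End MeanValue.

(** * Vectors split into two blocks *)

Section RowBlocks.
Variables (R : realType) (m n : nat).

Lemma dot_row_mx (a c : 'rV[R]_m) (b d : 'rV[R]_n) :
  dot (row_mx a b) (row_mx c d) = dot a c + dot b d.
Proof.
rewrite /dot big_split_ord /=; congr (_ + _); apply: eq_bigr => i _.
  by rewrite !row_mxEl.
by rewrite !row_mxEr.
Qed.

Lemma enorm_row_mxl (a : 'rV[R]_m) (b : 'rV[R]_n) : enorm a <= enorm (row_mx a b).
Proof. by rewrite ler_sqrt ?dot_ge0 // dot_row_mx lerDl dot_ge0. Qed.

Lemma enorm_row_mxr (a : 'rV[R]_m) (b : 'rV[R]_n) : enorm b <= enorm (row_mx a b).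
Proof. by rewrite ler_sqrt ?dot_ge0 // dot_row_mx lerDr dot_ge0. Qed.

Lemma enorm_row_mx_le (a : 'rV[R]_m) (b : 'rV[R]_n) :
  enorm (row_mx a b) <= enorm a + enorm b.
Proof.
rewrite -(ler_pXn2r (n := 2)) ?nnegrE ?addr_ge0 ?enorm_ge0 //.
rewrite sqr_enorm dot_row_mx -!sqr_enorm.
have := enorm_ge0 a; have := enorm_ge0 b; nra.
Qed.

Lemma sub_row_mx (a c : 'rV[R]_m) (b d : 'rV[R]_n) :
  row_mx a b - row_mx c d = row_mx (a - c) (b - d).
Proof. by rewrite opp_row_mx add_row_mx. Qed.

Lemma seq_cvg_row_mx (a : nat -> 'rV[R]_m) (b : nat -> 'rV[R]_n) c d :
  seq_cvg (fun k => row_mx (a k) (b k)) (row_mx c d) -> seq_cvg a c /\ seq_cvg b d.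
Proof.
move=> abcd; split=> e e0; have [N h] := abcd e e0; exists N => k /h;
  rewrite sub_row_mx; apply: le_lt_trans; [exact: enorm_row_mxl|exact: enorm_row_mxr].
Qed.

End RowBlocks.

(** * Convergence of vector sequences *)

Section Sequences.
Variables (R : realType) (n : nat).

Lemma seq_cvg_harmonic (z : nat -> 'rV[R]_n) l (C : R) :
  (forall k, enorm (z k - l) <= C * k.+1%:R^-1) -> seq_cvg z l.
Proof.
move=> zl e e0.
have /cvgrPdist_lt /(_ e e0) [N _ hN] : C * harmonic k @[k --> \oo] --> C * (0 : R).
  by apply: cvgMr; exact: cvg_harmonic.
exists N => k /hN /=; rewrite mulr0 sub0r normrN; apply: le_lt_trans.
exact: le_trans (zl k) (ler_norm _).
Qed.

Lemma seq_cvgN (z : nat -> 'rV[R]_n) l : seq_cvg z l -> seq_cvg (fun k => - z k) (- l).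
Proof.
by move=> zl e /zl[N h]; exists N => k /h; rewrite -opprD enormN.
Qed.

End Sequences.

(** * Regular normals to the graph of a locally Lipschitz map *)

Section RegularNormals.
Variables (R : realType) (n : nat).
Implicit Types (G : 'rV[R]_n -> 'rV[R]_n) (x xb u z : 'rV[R]_n) (r L e kappa a : R).

Definition lipschitz_ball G xb (r L : R) := forall y z,
  enorm (y - xb) < r -> enorm (z - xb) < r -> enorm (G y - G z) <= L * enorm (y - z).

(** Membership of [z] in the regular coderivative of [G] at [x] applied to [u]; the sign follows
    [coderiv]. *)
Definition graph_normal G x u z :=
  regular_normal (graph G) (row_mx x (G x)) (row_mx z (- u)).

Lemma graph_normalP G x u z e : graph_normal G x u z -> 0 < e ->
  exists2 d, 0 < d & forall y, enorm (y - x) + enorm (G y - G x) < d ->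
    dot z (y - x) - dot u (G y - G x) <= e * (enorm (y - x) + enorm (G y - G x)).
Proof.
move=> zu e0; have [d [d0 h]] := zu e e0; exists d => // y yd.
have := h (row_mx y (G y)); rewrite sub_row_mx dot_row_mx dotNl.
have le := enorm_row_mx_le (y - x) (G y - G x) => h'.
apply: le_trans (h' _ (le_lt_trans le yd)) _; first by exists y.
by rewrite ler_wpM2l // ltW.
Qed.

Lemma graph_normalZ G x u z a : 0 < a -> graph_normal G x u z ->
  graph_normal G x (a *: u) (a *: z).
Proof.
move=> a0 zu e e0; have [|d [d0 h]] := zu (e / a); first exact: divr_gt0.
exists d; split=> // w Gw wd.
rewrite -scalerN -scale_row_mx dotZl -ler_pdivlMl // mulrA [a^-1 * e]mulrC.
exact: h.
Qed.

(** A move from [x] by [t *: z] gains [t |z|^2] in the normal inequality, while [G] moves by at most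
    [L t |z|]; dividing by [t |z|] leaves [|z| <= L |u| + e]. *)
Lemma graph_normal_enorm_le G xb r L x u z : 0 <= L -> lipschitz_ball G xb r L ->
  enorm (x - xb) < r -> graph_normal G x u z -> enorm z <= L * enorm u.
Proof.
move=> L0 GL xr zu; have [->|z0] := eqVneq z 0.
  by rewrite enorm0 mulr_ge0 // enorm_ge0.
apply/ler_addgt0Pr => e e0.
have zp : 0 < enorm z by rewrite enorm_gt0.
have L1 : 0 < 1 + L by lra.
have [|d d0 hd] := graph_normalP zu (e := e / (1 + L)); first exact: divr_gt0.
pose m := Num.min d (r - enorm (x - xb)).
have m0 : 0 < m by rewrite lt_min d0 subr_gt0.
(* With this [t] the moved point stays in the ball, and its displacement on the graph, at most
   [t |z| (1 + L)], stays below [d]. *)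
pose t := m / 2 / (enorm z * (1 + L)).
have t0 : 0 < t by rewrite !divr_gt0 // mulr_gt0.
have tE : t * enorm z * (1 + L) = m / 2.
  by rewrite /t -mulrA divfK // gt_eqF // mulr_gt0.
have tm : t * enorm z <= m / 2 by rewrite -tE ler_peMr ?lerDl // mulr_ge0 // ltW.
have [md mr] : m <= d /\ m <= r - enorm (x - xb) by rewrite !ge_min !lexx orbT.
have yx : x + t *: z - x = t *: z by rewrite addrC addKr.
have nyx : enorm (t *: z) = t * enorm z by rewrite enormZ gtr0_norm.
have yr : enorm (x + t *: z - xb) < r.
  by have := ler_enormD (x - xb) (t *: z); rewrite addrAC nyx; lra.
have := GL _ _ yr xr; have := hd (x + t *: z); rewrite yx nyx.
set D := G _ - G x => hd' DL.
have DL' : L * (t * enorm z) = t * enorm z * (1 + L) - t * enorm z by ring.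
have hd2 : dot z (t *: z) - dot u D <= e / (1 + L) * (t * enorm z + enorm D).
  by apply: hd'; lra.
have {}hd2 : dot z (t *: z) - dot u D <= e * (t * enorm z).
  apply: le_trans hd2 _; rewrite -mulrA ler_pM2l // mulrC ler_pdivrMr //; lra.
have uD := dot_le_enorm u D.
have uDL : enorm u * enorm D <= enorm u * (L * (t * enorm z)).
  by rewrite ler_wpM2l ?enorm_ge0.
move: hd2; rewrite dotZr -sqr_enorm => hd2.
have tz : 0 < t * enorm z by rewrite mulr_gt0.
rewrite -(ler_pM2l tz); nra.
Qed.

(* A failure of coercivity along points tending to [xb] would produce, after
   normalising [u] and extracting a convergent subsequence, a limiting normal at
   [xb] contradicting positive definiteness there. *)
Lemma coercive_graph_normal G xb r L : 0 < r -> 0 <= L -> lipschitz_ball G xb r L ->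
  (forall u z, u != 0 -> hess2 G xb u z -> 0 < dot z u) ->
  exists2 kappa, 0 < kappa & exists2 r', 0 < r' <= r &
    forall x u z, enorm (x - xb) < r' -> graph_normal G x u z ->
      kappa * dot u u <= dot z u.
Proof.
move=> r0 L0 GL pd; apply: contrapT => H.
(* The failure is used with [kappa] equal to [1/(k+1)] and radius the minimum of this and [r]; a
   triple [p] stores the point, [u] and [z]. *)
have P (k : nat) : exists p : 'rV[R]_n * 'rV[R]_n * 'rV[R]_n,
    [/\ enorm (p.1.1 - xb) < r, enorm (p.1.1 - xb) < k.+1%:R^-1,
        graph_normal G p.1.1 p.1.2 p.2, dot p.1.2 p.1.2 = 1 &
        dot p.2 p.1.2 <= k.+1%:R^-1].
  have kp : 0 < k.+1%:R^-1 :> R by rewrite invr_gt0.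
  apply: contrapT => Hk; apply: H; exists k.+1%:R^-1 => //.
  exists (Num.min r k.+1%:R^-1); first by rewrite lt_min r0 ge_min lexx kp.
  move=> x u z; rewrite lt_min => /andP[xr xk] zu; rewrite leNgt; apply/negP => lt.
  have u0 : u != 0 by apply: contraTneq lt => ->; rewrite !dot0r mulr0 ltxx.
  have up : 0 < enorm u by rewrite enorm_gt0.
  have duu : 0 < dot u u by rewrite -sqr_enorm exprn_gt0.
  apply: Hk; exists (x, (enorm u)^-1 *: u, (enorm u)^-1 *: z); split=> //=.
  - by apply: graph_normalZ => //; rewrite invr_gt0.
  - by rewrite dotZl dotZr mulrA -expr2 exprVn sqr_enorm mulVf // gt_eqF.
  - rewrite dotZl dotZr mulrA -expr2 exprVn sqr_enorm mulrC ler_pdivrMr //.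
    exact: ltW.
have [f fP] := choice P.
pose W k := row_mx (f k).2 (- (f k).1.2).
have u1 k : enorm (f k).1.2 = 1 by have [_ _ _ h _] := fP k; rewrite /enorm h sqrtr1.
have [k|l lP] := @enorm_cluster_point _ _ W (L + 1).
  apply: le_trans (enorm_row_mx_le _ _) _; rewrite enormN u1 lerD2r.
  have [xr _ zu _ _] := fP k.
  by have := graph_normal_enorm_le L0 GL xr zu; rewrite u1 mulr1.
have Q (k : nat) : exists j, (k <= j)%N /\ enorm (W j - l) < k.+1%:R^-1.
  by have [|j kj lj] := lP k.+1%:R^-1 _ k; [rewrite invr_gt0|exists j].
have [g gP] := choice Q.
have inv_le k : (g k).+1%:R^-1 <= k.+1%:R^-1 :> R.
  by rewrite lef_pV2 ?posrE // ler_nat ltnS; have [] := gP k.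
pose us := - rsubmx l; pose zs := lsubmx l.
have Wl : seq_cvg (fun k => W (g k)) (row_mx zs (- us)).
  rewrite /us opprK hsubmxK; apply: (@seq_cvg_harmonic _ _ _ _ 1) => k.
  by rewrite mul1r ltW //; have [] := gP k.
have [zcv /seq_cvgN] := seq_cvg_row_mx Wl; rewrite opprK => ucv'.
have ucv : seq_cvg (fun k => (f (g k)).1.2) us.
  by move=> e /ucv'[N h]; exists N => k /h; rewrite opprK.
(* Unit length and the vanishing upper bound on the inner products survive the limit: [us] is
   nonzero, yet [<zs, us> <= 0]. *)
have us1 : 1 <= dot us us.
  apply: cvgr_to_ge (cvg_dot ucv ucv) _; exists 0%N => // k _ /=.
  by have [_ _ _ -> _] := fP (g k).
have zus : dot zs us <= 0.
  apply: ler_cvg_to (cvg_dot zcv ucv) (@cvg_harmonic R) _; exists 0%N => // k _ /=.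
  by have [_ _ _ _ h] := fP (g k); apply: le_trans h (inv_le k).
have us0 : us != 0 by rewrite -dot_eq0; apply: contraTneq us1 => ->; rewrite -ltNge.
suff /(pd _ _ us0) : hess2 G xb us zs by rewrite ltNge zus.
exists (fun k => row_mx (f (g k)).1.1 (G (f (g k)).1.1)), (fun k => W (g k)).
split; first by move=> k; exists (f (g k)).1.1.
split; first by move=> k; have [] := fP (g k).
split=> //; apply: (@seq_cvg_harmonic _ _ _ _ (1 + L)) => k.
rewrite sub_row_mx; apply: le_trans (enorm_row_mx_le _ _) _.
have [xr xk _ _ _] := fP (g k).
have xbr : enorm (xb - xb) < r by rewrite subrr enorm0.
have := GL _ _ xr xbr; have := inv_le k.
move: xk; set a := enorm (_ - xb); set b := _^-1; set c := _^-1; nra.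
Qed.

(** Both bounds hold for the regular normals approximating a limiting normal and are closed
    conditions, so they pass to the limit. *)
Lemma coercive_hess2 G xb r L kappa x u z : 0 <= L -> lipschitz_ball G xb r L ->
  (forall x u z, enorm (x - xb) < r -> graph_normal G x u z ->
      kappa * dot u u <= dot z u) ->
  enorm (x - xb) < r -> hess2 G x u z ->
  kappa * dot u u <= dot z u /\ enorm z <= L * enorm u.
Proof.
move=> L0 GL coer xr [w [v [wG [vN [wx vz]]]]].
have [y yP] := choice wG.
have wE : w = (fun k => row_mx (y k) (G (y k))) by apply/funext.
have [yx _] : seq_cvg y x /\ seq_cvg (fun k => G (y k)) (G x).
  by apply: seq_cvg_row_mx; rewrite -wE.
(* The double sign gives the second block the form [- u] expected by [graph_normal]. *)
have vE : v = (fun k => row_mx (lsubmx (v k)) (- - rsubmx (v k))).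
  by apply/funext => k; rewrite opprK hsubmxK.
have [zcv /seq_cvgN ucv'] : seq_cvg (fun k => lsubmx (v k)) z /\
    seq_cvg (fun k => - - rsubmx (v k)) (- u).
  by apply: seq_cvg_row_mx; rewrite -vE.
have ucv : seq_cvg (fun k => - rsubmx (v k)) u.
  by move=> e /ucv'[N h]; exists N => k /h; rewrite !opprK.
have [|N hN] := yx (r - enorm (x - xb)); first by rewrite subr_gt0.
have near_normal k : (N <= k)%N -> enorm (y k - xb) < r /\
    graph_normal G (y k) (- rsubmx (v k)) (lsubmx (v k)).
  move=> /hN yk; split; first by have := ler_dist_enormD (y k) x xb; lra.
  by rewrite /graph_normal opprK hsubmxK -yP; exact: vN.
split.
  have h1 : kappa * dot (- rsubmx (v k)) (- rsubmx (v k)) @[k --> \oo] --> kappa * dot u u.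
    by apply: cvgMr; exact: cvg_dot.
  apply: ler_cvg_to h1 (cvg_dot zcv ucv) _; exists N => // k /= /near_normal[a b].
  exact: coer a b.
rewrite -(ler_pXn2r (n := 2)) ?nnegrE ?mulr_ge0 ?enorm_ge0 // exprMn !sqr_enorm.
have h1 : L ^+ 2 * dot (- rsubmx (v k)) (- rsubmx (v k)) @[k --> \oo] -->
    L ^+ 2 * dot u u.
  by apply: cvgMr; exact: cvg_dot.
apply: ler_cvg_to (cvg_dot zcv zcv) h1 _; exists N => // k /= /near_normal[a b].
rewrite -!sqr_enorm -exprMn lerXn2r ?nnegrE ?mulr_ge0 ?enorm_ge0 //.
exact: graph_normal_enorm_le a b.
Qed.

End RegularNormals.

(** * Cylinders around a segment *)

Section Tube.
Variables (R : realType) (n : nat) (a v : 'rV[R]_n) (rho : R).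
Hypotheses (v0 : v != 0) (rho0 : 0 < rho).
Implicit Types (x y e : 'rV[R]_n).

(** Scaled so that [v] itself has coordinate 1. *)
Definition axial e : R := dot e v / dot v v.
Definition radial e : 'rV[R]_n := e - axial e *: v.
(** The axis extends to [a + 2 v], so that [a + v] lies midway and a penalty can act beyond it. *)
Definition tube : set 'rV[R]_n := [set y |
  0 <= axial (y - a) <= 2 /\ enorm (radial (y - a)) <= rho].

Let nv0 : 0 < enorm v. Proof. by rewrite enorm_gt0. Qed.
Let V0 : 0 < dot v v. Proof. by rewrite -sqr_enorm exprn_gt0. Qed.

Lemma axialD x y : axial (x + y) = axial x + axial y.
Proof. by rewrite /axial dotDl mulrDl. Qed.

Lemma radialD x y : radial (x + y) = radial x + radial y.
Proof. by rewrite /radial axialD scalerDl opprD addrACA. Qed.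

Lemma axialZ t : axial (t *: v) = t.
Proof. by rewrite /axial dotZl mulfK // gt_eqF. Qed.

Lemma radialZ t : radial (t *: v) = 0.
Proof. by rewrite /radial axialZ subrr. Qed.

Lemma axial_dot e : axial e * dot v v = dot e v.
Proof. by rewrite /axial divfK // gt_eqF. Qed.

Lemma dot_radial_axis e : dot (radial e) v = 0.
Proof. by rewrite /radial dotBl dotZl axial_dot subrr. Qed.

Lemma dot_axial_radial e :
  dot e e = axial e ^+ 2 * dot v v + dot (radial e) (radial e).
Proof.
have {1 2}-> : e = radial e + axial e *: v by rewrite subrK.
move: (radial e) (axial e) (dot_radial_axis e) => w t wv.
rewrite !dotE (dotC v) wv; ring.
Qed.

Lemma norm_axial_le e : `|axial e| * enorm v <= enorm e.
Proof.
rewrite -(ler_pM2r nv0) -mulrA -expr2 sqr_enorm -(gtr0_norm V0) -normrM axial_dot.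
exact: norm_dot_le.
Qed.

Lemma enorm_radial_le e : enorm (radial e) <= enorm e.
Proof.
by rewrite ler_enorm (dot_axial_radial e) lerDr mulr_ge0 ?sqr_ge0 ?dot_ge0.
Qed.

Lemma shift_sub x y : y - a = (x - a) + (y - x).
Proof. by rewrite [RHS]addrC subrKA. Qed.

(** Both coordinates are Lipschitz, so a constraint violated at [x] would keep tube points at a
    positive distance from [x]. *)
Lemma tube_closed x :
  (forall d : R, 0 < d -> exists2 y, tube y & enorm (y - x) < d) -> tube x.
Proof.
move=> near_x.
have P y : tube y -> [/\ - (axial (x - a) * enorm v) <= enorm (y - x),
    (axial (x - a) - 2) * enorm v <= enorm (y - x) &
    enorm (radial (x - a)) - rho <= enorm (y - x)].
  case; rewrite !(shift_sub x y) axialD radialD => /andP[h1 h2 h3].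
  have := norm_axial_le (y - x); have := enorm_radial_le (y - x).
  have := ler_enormB (radial (x - a) + radial (y - x)) (radial (y - x)).
  rewrite addrK => h4 h5 h6.
  have [h7 h8] := (ler_norm (axial (y - x)), ler_norm (- axial (y - x))).
  rewrite normrN in h8.
  have m t : t <= `|axial (y - x)| -> t * enorm v <= enorm (y - x).
    by move=> ht; apply: le_trans (ler_wpM2r (ltW nv0) ht) h6.
  split; [rewrite -mulNr; apply: m; lra|apply: m; lra|lra].
have Q (t : R) : (forall y, tube y -> t <= enorm (y - x)) -> t <= 0.
  move=> h; rewrite leNgt; apply/negP => t0; have [y /h ty] := near_x t t0; lra.
have h1 : - (axial (x - a) * enorm v) <= 0 by apply: Q => y /P[].
have h2 : (axial (x - a) - 2) * enorm v <= 0 by apply: Q => y /P[].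
have h3 : enorm (radial (x - a)) - rho <= 0 by apply: Q => y /P[].
split; last by rewrite -subr_le0.
by rewrite -(pmulr_lge0 _ nv0) -oppr_le0 h1 -subr_le0 -(pmulr_lle0 _ nv0).
Qed.

Lemma tube_enorm_le y : tube y -> enorm (y - a) <= 2 * enorm v + rho.
Proof.
case=> /andP[h1 h2] h3.
have {1}-> : y - a = radial (y - a) + axial (y - a) *: v by rewrite subrK.
apply: le_trans (ler_enormD _ _) _; rewrite enormZ ger0_norm // addrC.
by apply: lerD => //; rewrite ler_wpM2r // enorm_ge0.
Qed.

Lemma tube_axis t : 0 <= t <= 2 -> tube (a + t *: v).
Proof.
move=> ht; rewrite /tube /= addrC addKr axialZ radialZ enorm0.
by split=> //; exact: ltW.
Qed.

Lemma tube_interior y : 0 < axial (y - a) < 2 -> enorm (radial (y - a)) < rho ->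
  exists2 d : R, 0 < d & forall y', enorm (y' - y) < d -> tube y'.
Proof.
move=> /andP[h1 h2] h3.
exists (Num.min (axial (y - a) * enorm v)
  (Num.min ((2 - axial (y - a)) * enorm v) (rho - enorm (radial (y - a))))).
  by rewrite !lt_min subr_gt0 h3 mulr_gt0 //= mulr_gt0 // subr_gt0.
move=> y'; rewrite !lt_min => /and3P[d1 d2 d3].
rewrite /tube /= (shift_sub y y') axialD radialD.
have := norm_axial_le (y' - y); have := enorm_radial_le (y' - y).
have := ler_enormD (radial (y - a)) (radial (y' - y)) => h4 h5 h6.
have [h7 h8] := (ler_norm (axial (y' - y)), ler_norm (- axial (y' - y))).
rewrite normrN in h8; split; last lra.
have := ler_wpM2r (ltW nv0) h7; have := ler_wpM2r (ltW nv0) h8 => h9 h10.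
by apply/andP; split; rewrite -(ler_pM2r nv0); lra.
Qed.

End Tube.

(** * Penalization and a mean value inequality for proximal subgradients *)

Section ProximalMeanValue.
Variables (R : realType) (n : nat) (a v : 'rV[R]_n) (rho : R).
Hypotheses (v0 : v != 0) (rho0 : 0 < rho).
Implicit Types (f : 'rV[R]_n -> R) (x y : 'rV[R]_n).

Let nv0 : 0 < enorm v. Proof. by rewrite enorm_gt0. Qed.
Let V0 : 0 < dot v v. Proof. by rewrite -sqr_enorm exprn_gt0. Qed.

(** The squared positive part lies below its tangent at [s], of slope [2 max(s, 0)], plus
    [(t - s)^2]. *)
Lemma sqr_pos_part_le (s t : R) :
  Num.max t 0 ^+ 2 - Num.max s 0 ^+ 2 <= 2 * Num.max s 0 * (t - s) + (t - s) ^+ 2.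
Proof.
case: (leP t 0) => ht; case: (leP s 0) => hs.
- by have := sqr_ge0 (t - s); lra.
- by have := sqr_ge0 t; lra.
- by have := mulr_le0_ge0 hs (ltW ht); have := sqr_ge0 s; lra.
- by lra.
Qed.

Lemma sqr_pos_part_lip (s t : R) : s <= 1 -> t <= 1 ->
  Num.max t 0 ^+ 2 - Num.max s 0 ^+ 2 <= 2 * `|t - s|.
Proof.
have := ler_norm (t - s); have := normr_ge0 (t - s).
by case: (leP t 0) => ht; case: (leP s 0) => hs; nra.
Qed.

Section Penalty.
Variables (f : 'rV[R]_n -> R) (l c K N : R).
Hypotheses (K0 : 0 <= K) (N0 : 0 <= N).
Hypothesis fl : forall x y, tube a v rho x -> tube a v rho y -> f y - f x <= l * enorm (y - x).

(** The terms added to [f] are continuously differentiable, so at an interior minimiser minus their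
    gradient is a proximal subgradient of [f]. *)
Definition penalized y : R := f y - c * axial v (y - a)
  + K * Num.max (axial v (y - a) - 1) 0 ^+ 2
  + N * dot (radial v (y - a)) (radial v (y - a)).

Lemma penalized_min :
  exists2 y, tube a v rho y & forall x, tube a v rho x -> penalized y <= penalized x.
Proof.
(* The Lipschitz constant adds up those of the terms of [penalized] on the tube; [axial] contributes
   the factor [1/|v|], and [|w|^2] contributes [2 rho]. *)
apply: (@lipschitz_EVT_min _ _ _ _ (enorm a + (2 * enorm v + rho))
  (l + (`|c| + K * 2) / enorm v + N * (2 * rho))).
- by exists (a + 0 *: v); apply: tube_axis => //; rewrite lexx ler0n.
- move=> x /tube_enorm_le; have := ler_enormD a (x - a); rewrite subrKC; lra.
- exact: tube_closed.
move=> x y Tx Ty; have := fl Tx Ty.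
case: Tx Ty => [/andP[s0 s2] w2] [/andP[t0 t2] w3].
have E : axial v (y - x) = axial v (y - a) - axial v (x - a).
  by rewrite (shift_sub a x y) (axialD v (x - a)) [RHS]addrC addKr.
have F : radial v (y - x) = radial v (y - a) - radial v (x - a).
  by rewrite (shift_sub a x y) (radialD v (x - a)) [RHS]addrC addKr.
have h1 := norm_axial_le v0 (y - x); have h2 := enorm_radial_le v0 (y - x).
rewrite -ler_pdivlMr // in h1.
have h3 := @sqr_pos_part_lip (axial v (x - a) - 1) (axial v (y - a) - 1).
have h4 : enorm (radial v (y - a)) - enorm (radial v (x - a)) <= enorm (y - x).
  have := ler_enormD (radial v (y - x)) (radial v (x - a)).
  by rewrite {1}F subrK; lra.
rewrite /penalized -!sqr_enorm.
move: h1 h3 h4 s0 s2 t0 t2 w2 w3; rewrite E.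
move: (enorm_ge0 (radial v (x - a))) (enorm_ge0 (radial v (y - a))) (enorm_ge0 (y - x)).
move: (enorm (y - x)) (enorm (radial v (y - a))) (enorm (radial v (x - a))).
move: (axial v (x - a)) (axial v (y - a)) (f y) (f x) => s t fy fx d wy wx.
have -> : t - 1 - (s - 1) = t - s by ring.
set Q := Num.max _ _ ^+ 2; set P := Num.max _ _ ^+ 2.
move=> wx0 wy0 d0 h1 h3 h4 s0 s2 t0 t2 w2 w3 hf.
have {}h3 : Q - P <= 2 * `|t - s| by apply: h3; lra.
have e1 : K * (Q - P) <= K * (2 * (d / enorm v)) by rewrite ler_wpM2l //; lra.
have e2 : - (c * (t - s)) <= `|c| * (d / enorm v).
  apply: le_trans (ler_norm _) _; rewrite normrN normrM.
  by rewrite ler_wpM2l.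
have e3 : N * (wy ^+ 2 - wx ^+ 2) <= N * (2 * rho * d) by rewrite ler_wpM2l //; nra.
have -> : (l + (`|c| + K * 2) / enorm v + N * (2 * rho)) * d =
  l * d + K * (2 * (d / enorm v)) + `|c| * (d / enorm v) + N * (2 * rho * d) by ring.
lra.
Qed.

(** Here [z] is minus the gradient at [y] of the terms added to [f]. The axial penalty has
    nonnegative slope, whence [<z, v> <= c]; the quadratic term absorbs the second-order remainders
    of both penalties. *)
Lemma penalized_subgradient y d : 0 < d ->
  (forall x, enorm (x - y) < d -> penalized y <= penalized x) ->
  let z := ((c - 2 * K * Num.max (axial v (y - a) - 1) 0) / dot v v) *: v
    - (2 * N) *: radial v (y - a) in
  dot z v <= c /\ forall x, enorm (x - y) < d ->
    dot z (x - y) - (K / dot v v + N) * dot (x - y) (x - y) <= f x - f y.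
Proof.
move=> d0 ymin z; rewrite /z; split.
  rewrite dotBl !dotZl dot_radial_axis // divfK ?gt_eqF // mulr0 subr0.
  by rewrite lerBlDr lerDl !mulr_ge0 // le_max lexx orbT.
move=> x /ymin; rewrite /penalized (shift_sub a y x) (axialD v (y - a)) (radialD v (y - a)).
set e := x - y; set w := radial v (y - a); set s := axial v (y - a).
have wv : dot w v = 0 by exact: dot_radial_axis.
have -> : dot (w + radial v e) (w + radial v e) =
    dot w w + 2 * dot w e + dot (radial v e) (radial v e).
  have wre : dot w (radial v e) = dot w e by rewrite dotBr dotZr wv mulr0 subr0.
  by rewrite dot_sqrD wre.
have -> : dot ((c - 2 * K * Num.max (s - 1) 0) / dot v v *: v - (2 * N) *: w) e =
    (c - 2 * K * Num.max (s - 1) 0) * axial v e - 2 * N * dot w e.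
  by rewrite dotBl !dotZl /axial (dotC v e); ring.
have := @sqr_pos_part_le (s - 1) (s + axial v e - 1).
have -> : s + axial v e - 1 - (s - 1) = axial v e by ring.
have ee := dot_axial_radial v0 e.
have -> : (K / dot v v + N) * dot e e = K * (axial v e ^+ 2) +
    K * (dot (radial v e) (radial v e) / dot v v) + N * axial v e ^+ 2 * dot v v +
    N * dot (radial v e) (radial v e).
  by rewrite ee; field; rewrite gt_eqF.
have q1 : 0 <= K * (dot (radial v e) (radial v e) / dot v v).
  by rewrite mulr_ge0 // divr_ge0 ?dot_ge0.
have q2 : 0 <= N * axial v e ^+ 2 * dot v v by rewrite mulr_ge0 ?dot_ge0 // mulr_ge0 ?sqr_ge0.
move=> /(ler_wpM2l K0); lra.
Qed.

End Penalty.

(* The penalty [K (s-1)_+^2] keeps a minimiser off the far end [s = 2] of the tube,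
   [N |w|^2] keeps it off the lateral boundary, and since the latter also forces
   [|w| = O(1/N)], the strict inequality [f (a + v) - f a < c] keeps it off [s = 0]. *)
Lemma proximal_mean_value f (l c : R) : 0 <= l ->
  (forall x y, tube a v rho x -> tube a v rho y -> f y - f x <= l * enorm (y - x)) ->
  f (a + v) - f a < c ->
  exists y z (C d : R), [/\ tube a v rho y, 0 < d, dot z v <= c &
    forall x, enorm (x - y) < d -> dot z (x - y) - C * dot (x - y) (x - y) <= f x - f y].
Proof.
move=> l0 fl fc.
pose delta : R := c - (f (a + v) - f a).
have del0 : 0 < delta by rewrite subr_gt0.
(* At [s = 2], comparison with [a + v] would give [K <= |c| + l (|v| + rho)]. The choice of [N]
   ensures [l < N rho] and [l^2 < N delta]. *)
pose K : R := `|c| + l * (enorm v + rho) + 1.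
pose N : R := l / rho + l ^+ 2 / delta + 1.
have K0 : 0 <= K by rewrite !addr_ge0 // mulr_ge0 // ltW // ltr_wpDr // ltW.
have N1 : l < N * rho.
  rewrite /N !mulrDl divfK ?gt_eqF // mul1r.
  rewrite -addrA ltrDl ltr_wpDl // mulr_ge0 ?(ltW rho0) //.
  by rewrite divr_ge0 ?sqr_ge0 // ltW.
have N2 : l ^+ 2 < N * delta.
  rewrite /N !mulrDl [l ^+ 2 / _ * _]divfK ?gt_eqF // mul1r.
  rewrite addrAC ltrDr ltr_wpDl // mulr_ge0 ?(ltW del0) //.
  by rewrite divr_ge0 // ltW.
have N0 : 0 < N by rewrite -(pmulr_lgt0 _ rho0) (le_lt_trans l0).
have [y Ty ymin] := penalized_min c K0 (ltW N0) fl.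
set s := axial v (y - a) in Ty *; set w := radial v (y - a) in Ty *.
have yE : y = a + s *: v + w by rewrite -addrA [s *: v + _]addrC subrK subrKC.
have [s02 wrho] : 0 <= s <= 2 /\ enorm w <= rho by [].
have Tp : tube a v rho (a + s *: v) by exact: tube_axis.
have Tb : tube a v rho (a + 1 *: v) by apply: tube_axis => //; rewrite ler01 ler1n.
have penE t : penalized f c K N (a + t *: v) =
    f (a + t *: v) - c * t + K * Num.max (t - 1) 0 ^+ 2.
  have E : a + t *: v - a = t *: v by rewrite addrC addKr.
  by rewrite /penalized E axialZ // radialZ // dot0l mulr0 addr0.
(* The minimiser is compared with its projection onto the axis, which bounds [|w|], and with
   [a + v], which excludes both ends. *)
have hp := ymin _ Tp; have hb := ymin _ Tb; move: hp hb; rewrite !penE.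
rewrite /penalized -/s -/w -sqr_enorm subrr maxxx expr0n /= mulr0 addr0 mulr1 scale1r.
move=> hp hb; have w0 := enorm_ge0 w.
have lw : f (a + s *: v) - f y <= l * enorm w.
  apply: le_trans (fl _ _ Ty Tp) _.
  by rewrite enorm_distC [y in y - _]yE [_ + w]addrC addrK.
have wN : N * enorm w ^+ 2 <= l * enorm w by lra.
have wlt : enorm w < rho.
  rewrite lt_neqAle wrho andbT; apply/negP => /eqP wE.
  by move: wN; rewrite wE; nra.
have sgt0 : 0 < s.
  rewrite lt_neqAle (andP s02).1 andbT eq_sym; apply/negP => /eqP sE.
  move: lw hb; rewrite sE scale0r addr0 mulr0 subr0 sub0r max_r ?oppr_le0 //.
  rewrite expr0n /= mulr0 addr0 => lw hb.
  (* Multiplied by [N], the right side is at most [l^2 / 4] by completing the square, against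
     [l^2 < N delta]. *)
  have dw : delta <= l * enorm w - N * enorm w ^+ 2 by rewrite /delta; lra.
  have := ler_wpM2l (ltW N0) dw; have := sqr_ge0 (l - 2 * N * enorm w).
  have := sqr_ge0 l; nra.
have slt2 : s < 2.
  rewrite lt_neqAle (andP s02).2 andbT; apply/negP => /eqP sE.
  move: hb; rewrite sE.
  have -> : Num.max (2 - 1) 0 = 1 :> R by rewrite max_l; lra.
  rewrite expr1n mulr1 => hb.
  have : f (a + v) - f y <= l * (enorm v + rho).
    rewrite scale1r in Tb; apply: le_trans (fl _ _ Ty Tb) _; rewrite ler_wpM2l //.
    have E (p q : 'rV[R]_n) : p + v - (p + 2 *: v + q) = - v - q.
      by apply/rowP => i; rewrite !mxE; ring.
    rewrite [y in _ - y]yE sE E.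
    by apply: le_trans (ler_enormB _ _) _; rewrite enormN lerD2l.
  have := ler_norm c; have : 0 <= N * enorm w ^+ 2 by rewrite mulr_ge0 ?sqr_ge0 ?ltW.
  rewrite /K in hb; lra.
have [||d d0 dT] := @tube_interior _ _ a v rho v0 y; [by rewrite -/s sgt0|by []|].
have [zc zs] := penalized_subgradient K0 (ltW N0) d0 (fun x xd => ymin x (dT x xd)).
by eexists y, _, _, d; split; [| |exact: zc|exact: zs].
Qed.

End ProximalMeanValue.

(** * From coercive normals to strong monotonicity *)

Section StrongMonotonicity.
Variables (R : realType) (n : nat).

(** If the inequality failed for [a] and [b], the function [<v, G>] with [v = b - a] would have a
    proximal subgradient [z] with [<z, v> < kappa |v|^2]; but then [(z, -v)] is a regular normal to
    the graph, contradicting coercivity. *)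
Lemma strongly_monotone (G : 'rV[R]_n -> 'rV[R]_n) xb (r L kappa : R) :
  0 < r -> 0 <= L -> lipschitz_ball G xb r L ->
  (forall x u z, enorm (x - xb) < r -> graph_normal G x u z ->
      kappa * dot u u <= dot z u) ->
  forall x y, enorm (x - xb) < r / 8 -> enorm (y - xb) < r / 8 ->
    kappa * dot (y - x) (y - x) <= dot (G y - G x) (y - x).
Proof.
move=> r0 L0 GL coer a b ar br.
have [->|ba] := eqVneq b a; first by rewrite !subrr dot0l mulr0.
set v := b - a; have v0 : v != 0 by rewrite subr_eq0.
rewrite leNgt; apply/negP => lt.
(* The midpoint is strictly above the increment of [<v, G>] and strictly below [kappa |v|^2]. *)
pose c := (dot (G b - G a) v + kappa * dot v v) / 2.
have rho0 : 0 < r / 8 by rewrite divr_gt0.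
have vr : enorm v < r / 4.
  have := ler_dist_enormD b xb a; rewrite (enorm_distC xb a) -/v; lra.
(* The radius [r / 8] leaves room for the doubled axis: [2 |v| + r/8 + r/8 < r]. *)
have Tr y : tube a v (r / 8) y -> enorm (y - xb) < r.
  by move=> /tube_enorm_le; have := ler_dist_enormD y a xb; lra.
pose f y := dot v (G y).
have [|||y [z [C [d [Ty d0 zc zf]]]]] :=
  @proximal_mean_value _ _ a v (r / 8) v0 rho0 f (enorm v * L) c.
- by rewrite mulr_ge0 ?enorm_ge0.
- move=> x y /Tr xr /Tr yr; rewrite /f -dotBr.
  apply: le_trans (dot_le_enorm _ _) _; rewrite -mulrA ler_wpM2l ?enorm_ge0 //.
  exact: GL.
- by rewrite /f -dotBr [a + v]subrKC dotC /c; lra.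
suff /(coer _ _ _ (Tr _ Ty)) : graph_normal G y v z by move: zc lt; rewrite /c; lra.
move=> e e0; have C0 : 0 < `|C| + 1 by rewrite ltr_wpDl.
(* Within this distance the quadratic error [C |x - y|^2] is at most [e |x - y|]. *)
exists (Num.min d (e / (`|C| + 1))); split; first by rewrite lt_min d0 divr_gt0.
move=> _ [x ->]; rewrite sub_row_mx lt_min => /andP[xd xe].
have le := enorm_row_mxl (x - y) (G x - G y).
rewrite dot_row_mx dotNl; have := zf x (le_lt_trans le xd); rewrite /f -dotBr -sqr_enorm.
have e1 : C * enorm (x - y) ^+ 2 <= (`|C| + 1) * enorm (x - y) ^+ 2.
  by rewrite ler_wpM2r ?sqr_ge0 // ler_wpDr // ler_norm.
have e2 : (`|C| + 1) * enorm (x - y) ^+ 2 <= e * enorm (x - y).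
  rewrite expr2 mulrA ler_wpM2r ?enorm_ge0 // mulrC -ler_pdivlMr //.
  by apply: le_trans le (ltW xe).
have := ler_wpM2l (ltW e0) le; lra.
Qed.

End StrongMonotonicity.

(** * Local strong convexity and tilt stability *)

Section LocalTheory.
Variables (R : realType) (n : nat) (phi : 'rV[R]_n -> R) (grad : 'rV[R]_n -> 'rV[R]_n).
Implicit Types (x y xb u v z d : 'rV[R]_n).

(** Collects on one ball all the local estimates used for tilt stability and for the Newton
    steps. *)
Lemma local_coercivity xb : C11 phi grad ->
  (forall u z, u != 0 -> hess2 grad xb u z -> 0 < dot z u) ->
  exists r kappa L : R, [/\ [/\ 0 < r, 0 < kappa & 0 < L],
    lipschitz_ball grad xb r L,
    forall x y, enorm (x - xb) < r -> enorm (y - xb) < r ->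
      kappa * dot (y - x) (y - x) <= dot (grad y - grad x) (y - x) &
    forall x u z, enorm (x - xb) < r -> hess2 grad x u z ->
      kappa * dot u u <= dot z u /\ enorm z <= L * enorm u].
Proof.
move=> [_ /(_ xb)[r [r0 [L GL]]]] pd.
have GL' : lipschitz_ball grad xb r (`|L| + 1).
  move=> y z yr zr; apply: le_trans (GL y z yr zr) _.
  by rewrite ler_wpM2r ?enorm_ge0 // ler_wpDr // ler_norm.
have L0 : 0 < `|L| + 1 by rewrite ltr_wpDl.
have [kappa kappa0 [r' /andP[r'0 r'r] coer]] :=
  coercive_graph_normal r0 (ltW L0) GL' pd.
have GL2 : lipschitz_ball grad xb r' (`|L| + 1).
  by move=> y z yr zr; apply: GL'; exact: lt_le_trans r'r.
have r8 x : enorm (x - xb) < r' / 8 -> enorm (x - xb) < r' by lra.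
exists (r' / 8), kappa, (`|L| + 1); split.
- by split=> //; rewrite divr_gt0.
- by move=> y z /r8 yr /r8 zr; exact: GL2.
- exact: strongly_monotone r'0 (ltW L0) GL2 coer.
- by move=> x u z /r8 xr; exact: coercive_hess2 (ltW L0) GL2 coer xr.
Qed.

Lemma gradient_continuous x g : is_gradient phi x g -> forall e : R, 0 < e ->
  exists2 d : R, 0 < d & forall y, enorm (y - x) < d -> `|phi y - phi x| < e.
Proof.
move=> gx e e0; have [d [d0 hd]] := gx 1 ltr01.
have C0 : 0 < enorm g + 1 by rewrite ltr_wpDl ?enorm_ge0.
exists (Num.min d (e / (enorm g + 1))); first by rewrite lt_min d0 divr_gt0.
move=> y; rewrite lt_min ltr_pdivlMr // => /andP[/hd yd ye].
have := norm_dot_le g (y - x).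
have := ler_normD (phi y - phi x - dot g (y - x)) (dot g (y - x)).
rewrite subrK; lra.
Qed.

Lemma segment_ball xb r x y (t : R) : 0 <= t <= 1 ->
  enorm (x - xb) < r -> enorm (y - xb) < r -> enorm (x + t *: (y - x) - xb) < r.
Proof.
move=> /andP[t0 t1] xr yr.
have -> : x + t *: (y - x) - xb = (1 - t) *: (x - xb) + t *: (y - xb).
  by apply/rowP => i; rewrite !mxE; ring.
apply: le_lt_trans (ler_enormD _ _) _; rewrite !enormZ !ger0_norm ?subr_ge0 //.
set M := Num.max (enorm (x - xb)) (enorm (y - xb)).
have Mr : M < r by rewrite gt_max xr yr.
have xM : (1 - t) * enorm (x - xb) <= (1 - t) * M.
  by rewrite ler_wpM2l ?subr_ge0 // le_max lexx.
have yM : t * enorm (y - xb) <= t * M by rewrite ler_wpM2l // le_max lexx orbT.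
lra.
Qed.

Section Ball.
Variables (xb : 'rV[R]_n) (r kappa L : R).
Hypotheses (r0 : 0 < r) (kappa0 : 0 < kappa) (L0 : 0 < L).
Hypothesis gphi : forall x, is_gradient phi x (grad x).
Hypothesis GL : lipschitz_ball grad xb r L.
Hypothesis mono : forall x y, enorm (x - xb) < r -> enorm (y - xb) < r ->
  kappa * dot (y - x) (y - x) <= dot (grad y - grad x) (y - x).

Let center_in : enorm (xb - xb) < r. Proof. by rewrite subrr enorm0. Qed.

(** The mean value point is within [|y - x|] of [x], which gives the constant [L]; the sharper
    [L / 2] would come from integration. *)
Lemma descent_le x y : enorm (x - xb) < r -> enorm (y - xb) < r ->
  phi y - phi x <= dot (grad x) (y - x) + L * dot (y - x) (y - x).
Proof.
move=> xr yr; have [t /andP[t0 t1] ->] := gradient_mean_value x y gphi.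
have tr := @segment_ball xb r x y t; rewrite -lerBlDl -dotBl.
apply: le_trans (dot_le_enorm _ _) _.
apply: (@le_trans _ _ (L * enorm (x + t *: (y - x) - x) * enorm (y - x))).
  by rewrite ler_wpM2r ?enorm_ge0 // GL // tr // (ltW t0) ltW.
rewrite addrC addKr enormZ (gtr0_norm t0) -sqr_enorm expr2 -mulrA ler_wpM2l ?(ltW L0) //.
by rewrite -mulrA ler_piMl ?(ltW t1) // mulr_ge0 ?enorm_ge0.
Qed.

(** A single mean value point could be arbitrarily close to [x], so the segment is halved: on the
    second half the point has parameter at least 1/2, and half the segment at slope gain [kappa / 2]
    yields [kappa / 4]. *)
Lemma strongly_convex_ge x y : enorm (x - xb) < r -> enorm (y - xb) < r ->
  dot (grad x) (y - x) + kappa / 4 * dot (y - x) (y - x) <= phi y - phi x.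
Proof.
move=> xr yr.
have slope t : 0 < t -> t <= 1 -> dot (grad x) (y - x) + kappa * t * dot (y - x) (y - x) <=
    dot (grad (x + t *: (y - x))) (y - x).
  move=> t0 t1; have tr : enorm (x + t *: (y - x) - xb) < r.
    by apply: segment_ball => //; rewrite (ltW t0).
  have := mono xr tr; rewrite [x + _ - x]addrC addKr !dotZl !dotZr.
  rewrite (dotBl (grad _)) mulrCA ler_pM2l //; lra.
set m := x + 2^-1 *: (y - x).
have mx : m - x = 2^-1 *: (y - x) by rewrite /m addrC addKr.
have ym : y - m = 2^-1 *: (y - x).
  by apply/rowP => i; rewrite /m !mxE; field.
have [t /andP[t0 t1]] := gradient_mean_value x m gphi.
have [s /andP[s0 s1]] := gradient_mean_value m y gphi.
rewrite mx ym !dotZr.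
have -> : m + s *: (2^-1 *: (y - x)) = x + (2^-1 + s * 2^-1) *: (y - x).
  by rewrite /m scalerA scalerDl addrA.
rewrite scalerA => h1 h2.
have V0 := dot_ge0 (y - x).
have e1 := slope (2^-1 + s * 2^-1) ltac:(lra) ltac:(lra).
have e2 := slope (t * 2^-1) ltac:(lra) ltac:(lra).
have k1 : 0 <= kappa * (t * 2^-1) * dot (y - x) (y - x).
  by rewrite !mulr_ge0 // ?invr_ge0 // ltW.
have k2 : 0 <= kappa * (s * 2^-1) * dot (y - x) (y - x).
  by rewrite !mulr_ge0 // ?invr_ge0 // ltW.
lra.
Qed.

(** Otherwise a short step along [v - grad x] would stay in the ball and lower the tilted
    function. *)
Lemma tilt_stationary gamma v x : gamma < r -> enorm (x - xb) < gamma ->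
  tilt_argmin phi gamma xb v x -> grad x = v.
Proof.
move=> gr xg [_ xmin]; apply/eqP; rewrite -subr_eq0; apply: contraTT xg => g0.
rewrite -leNgt leNgt; apply/negP => xg.
set g := grad x - v in g0; have gp : 0 < enorm g by rewrite enorm_gt0.
pose t : R := Num.min (L^-1 / 2) ((gamma - enorm (x - xb)) / enorm g).
have t0 : 0 < t by rewrite lt_min !divr_gt0 ?invr_gt0 // subr_gt0.
have tL : L * t <= 2^-1.
  have : t <= L^-1 / 2 by rewrite ge_min lexx.
  by rewrite -(ler_pM2l L0) mulrA divff ?gt_eqF // div1r.
have tg : t * enorm g <= gamma - enorm (x - xb).
  by rewrite -ler_pdivlMr // ge_min lexx orbT.
have yx : x - t *: g - x = - (t *: g) by rewrite addrAC subrr add0r.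
have yg : enorm (x - t *: g - xb) <= gamma.
  rewrite addrAC; apply: le_trans (ler_enormB _ _) _.
  by rewrite enormZ gtr0_norm //; lra.
have xr : enorm (x - xb) < r by exact: lt_trans gr.
have := xmin _ yg; have := descent_le xr (le_lt_trans yg gr).
rewrite yx !dotNr dotNl dotZl !dotZr opprK (dotBr x (t *: g) v) dotZr => h1 h2.
have E : dot g g = dot (grad x) g - dot v g by rewrite {1}/g dotBl.
have gg : 0 < dot g g by rewrite -sqr_enorm exprn_gt0.
have tgg : 0 < t * dot g g by rewrite mulr_gt0.
have := ler_wpM2r (ltW tgg) tL; nra.
Qed.

(** Minimisers exist by compactness and, for small [v], are interior, so they solve [grad x = v];
    strong monotonicity then gives uniqueness and the Lipschitz constant [kappa^-1]. *)
Lemma tilt_stable_stationary : grad xb = 0 -> tilt_stable phi xb.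
Proof.
move=> gxb; pose gamma : R := r / 2; pose delta : R := kappa * gamma / 4.
have gamma0 : 0 < gamma by rewrite divr_gt0.
have gr : gamma < r by rewrite /gamma ltr_pdivrMr // ltr_pMr // ltr1n.
have delta0 : 0 < delta by rewrite divr_gt0 // mulr_gt0.
have in_ball x : enorm (x - xb) <= gamma -> enorm (x - xb) < r.
  by move=> h; exact: le_lt_trans gr.
have growth x : enorm (x - xb) <= gamma -> kappa / 4 * enorm (x - xb) ^+ 2 <= phi x - phi xb.
  by move=> /in_ball xr; have := strongly_convex_ge center_in xr; rewrite gxb dot0l add0r sqr_enorm.
have crit v x : enorm v < delta -> tilt_argmin phi gamma xb v x ->
    enorm (x - xb) < r /\ grad x = v.
  move=> vd xmin; have [xg xm] := xmin; split; first exact: in_ball.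
  (* On the sphere [phi] exceeds [phi xb] by at least [kappa gamma^2 / 4 = delta gamma], more than
     the tilt [|v| gamma] can offset. *)
  apply: tilt_stationary gr _ xmin; rewrite lt_neqAle xg andbT; apply/negP => /eqP xE.
  have := xm xb; rewrite subrr enorm0 => /(_ (ltW gamma0)).
  have := growth x xg; have := dot_le_enorm v (x - xb); rewrite dotBr xE.
  have := ltr_pM2r gamma0 (enorm v) delta; rewrite vd /delta; nra.
have lip v w x y : enorm v < delta -> enorm w < delta ->
    tilt_argmin phi gamma xb v x -> tilt_argmin phi gamma xb w y ->
    enorm (x - y) <= kappa^-1 * enorm (v - w).
  move=> vd wd /(crit _ _ vd)[xr <-] /(crit _ _ wd)[yr <-].
  have [->|xy] := eqVneq x y; first by rewrite !subrr !enorm0 mulr0.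
  have xyp : 0 < enorm (x - y) by rewrite enorm_gt0 subr_eq0.
  rewrite ler_pdivlMl // -(ler_pM2r xyp) -mulrA -expr2 sqr_enorm.
  by apply: le_trans (mono yr xr) (dot_le_enorm _ _).
have ex v : exists x, enorm v < delta -> tilt_argmin phi gamma xb v x.
  have [||||x xg xm] := @lipschitz_EVT_min _ _ [set x | enorm (x - xb) <= gamma]
    (fun x => phi x - dot v x) (enorm xb + gamma) (enorm (grad xb) + L * r + enorm v).
  - by exists xb; rewrite /= subrr enorm0 ltW.
  - by move=> x /= xg; have := ler_enormD xb (x - xb); rewrite subrKC; lra.
  - move=> x xc /=; rewrite leNgt; apply/negP => xg.
    have [|y /= yg yx] := xc (enorm (x - xb) - gamma); first by rewrite subr_gt0.
    by have := ler_dist_enormD x y xb; rewrite (enorm_distC x y); lra.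
  - move=> x y /in_ball xr /in_ball yr.
    have [t /andP[t0 t1] pE] := gradient_mean_value x y gphi.
    have tr : enorm (x + t *: (y - x) - xb) < r.
      by apply: segment_ball => //; rewrite (ltW t0) ltW.
    have := GL tr center_in; move: tr pE; set q := x + _ => qr pE qL.
    have := ler_enormD (grad xb) (grad q - grad xb); rewrite subrKC => qn.
    have nq : enorm (grad q) <= enorm (grad xb) + L * r.
      by have := ler_wpM2l (ltW L0) (ltW qr); lra.
    have := ler_wpM2r (enorm_ge0 (y - x)) nq.
    have := dot_le_enorm (grad q) (y - x); have := dot_le_enorm v (x - y).
    rewrite (enorm_distC x y) dotBr; lra.
  by exists x => _; split.
have [M MP] := choice ex.
exists gamma; split=> //; exists delta; split=> //; exists M, kappa^-1.
have uniq v x : enorm v < delta -> tilt_argmin phi gamma xb v x -> x = M v.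
  move=> vd xm; have := lip v v x (M v) vd vd xm (MP v vd).
  rewrite subrr enorm0 mulr0 => le0; apply/eqP; rewrite -subr_eq0 -enorm_eq0.
  by rewrite eq_le le0 enorm_ge0.
split=> [v vd x|]; first by split=> [|->]; [exact: uniq|exact: MP].
split=> [v w vd wd|]; first exact: lip (MP v vd) (MP w wd).
apply/esym/uniq; first by rewrite enorm0.
split=> [|y yg]; first by rewrite subrr enorm0 ltW.
rewrite !dot0l !subr0 -subr_ge0; apply: le_trans (growth y yg).
by rewrite mulr_ge0 ?sqr_ge0 // divr_ge0 // ltW.
Qed.

End Ball.
End LocalTheory.

(** * Estimates for one damped Newton step *)

Section NewtonSteps.
Variables (R : realType) (n : nat) (phi : 'rV[R]_n -> R) (grad : 'rV[R]_n -> 'rV[R]_n).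
Variables (sigma beta : R).
Hypotheses (sigma0 : 0 < sigma) (sigma1 : sigma < 1) (beta0 : 0 < beta) (beta1 : beta < 1).
Implicit Types (x y xb u v z d : 'rV[R]_n).

Lemma gdn_step_descent x y :
  (forall u z, u != 0 -> hess2 grad x u z -> 0 < dot z u) ->
  gdn_step phi grad sigma beta x y -> phi y <= phi x.
Proof.
rewrite /gdn_step => pd; case: eqP => [_ -> //|_ [d [dN [j [_ [le ->]]]]]].
apply: le_trans le _; rewrite gerDl mulr_ge0_le0 //.
  by rewrite mulr_ge0 ?exprn_ge0 // ltW.
have [->|d0] := eqVneq d 0; first by rewrite dot0r.
by have := pd _ _ d0 dN; rewrite dotNl oppr_gt0 => /ltW.
Qed.

Section Ball.
Variables (xb : 'rV[R]_n) (r kappa L : R).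
Hypotheses (r0 : 0 < r) (kappa0 : 0 < kappa) (L0 : 0 < L).
Hypothesis gphi : forall x, is_gradient phi x (grad x).
Hypothesis GL : lipschitz_ball grad xb r L.
Hypothesis coer : forall x u z, enorm (x - xb) < r -> hess2 grad x u z ->
  kappa * dot u u <= dot z u /\ enorm z <= L * enorm u.

(** Coercivity applied to the pair [d], [- grad x]: the direction is one of descent and comparable
    in length with the gradient. *)
Lemma newton_direction_bounds x d : enorm (x - xb) < r -> hess2 grad x d (- grad x) ->
  [/\ kappa * enorm d ^+ 2 <= - dot (grad x) d, enorm (grad x) <= L * enorm d &
      kappa * enorm d <= enorm (grad x)].
Proof.
move=> xr dN; have [h1 h2] := coer xr dN; rewrite dotNl in h1; rewrite enormN in h2.
split=> //; first by rewrite sqr_enorm.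
have [->|d0] := eqVneq d 0; first by rewrite enorm0 mulr0 enorm_ge0.
have dp : 0 < enorm d by rewrite enorm_gt0.
rewrite -(ler_pM2r dp) -mulrA -expr2 sqr_enorm (le_trans h1) //.
by rewrite -dotNl (le_trans (dot_le_enorm _ _)) // enormN.
Qed.

Lemma gdn_step_dist x y : enorm (x - xb) < r ->
  gdn_step phi grad sigma beta x y -> kappa * enorm (y - x) <= enorm (grad x).
Proof.
rewrite /gdn_step => xr; case: eqP => [_ ->|_ [d [dN [j [_ [_ ->]]]]]].
  by rewrite subrr enorm0 mulr0 enorm_ge0.
have [_ _ h] := newton_direction_bounds xr dN; apply: le_trans h.
rewrite addrC addKr enormZ ler_wpM2l ?(ltW kappa0) // ger0_norm ?exprn_ge0 ?(ltW beta0) //.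
by rewrite ler_piMl ?enorm_ge0 // exprn_ile1 // ltW.
Qed.

(* The bound [tau0] is the step length below which the descent inequality alone
   guarantees the Armijo test, so backtracking never goes below [beta * tau0]. *)
Lemma armijo_decrease (g1 g2 : R) : 0 < g1 ->
  exists2 Delta : R, 0 < Delta & forall x y, enorm (x - xb) < r / 2 ->
    g1 <= enorm (grad x) <= g2 -> gdn_step phi grad sigma beta x y ->
    phi y <= phi x - Delta.
Proof.
move=> g10.
(* The first bound makes the descent inequality imply the Armijo test; the second keeps the trial
   point in the ball of radius [r]. *)
pose tau0 : R := Num.min (kappa * (1 - sigma) / L) (r / 2 / (`|g2| / kappa + 1)).
have q0 : 0 < `|g2| / kappa + 1 by rewrite ltr_wpDl // divr_ge0 // ltW.
have tau00 : 0 < tau0 by rewrite lt_min !divr_gt0 // mulr_gt0 // subr_gt0.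
pose tau1 : R := Num.min 1 (beta * tau0).
have tau10 : 0 < tau1 by rewrite lt_min ltr01 mulr_gt0.
exists (sigma * tau1 * (kappa * (g1 / L) ^+ 2)).
  by apply: mulr_gt0; apply: mulr_gt0 => //; rewrite exprn_gt0 // divr_gt0.
move=> x y xr2 /andP[gx1 gx2].
have xr : enorm (x - xb) < r.
  by apply: lt_trans xr2 _; rewrite ltr_pdivrMr // ltr_pMr // ltr1n.
rewrite /gdn_step; case: eqP => [gx0|_ [d [dN [j [jmin [le ->]]]]]].
  by move: gx1; rewrite gx0 enorm0 leNgt g10.
have [h1 h2 h3] := newton_direction_bounds xr dN.
have dge : g1 / L <= enorm d by rewrite ler_pdivrMr // mulrC (le_trans gx1).
have dle : enorm d < `|g2| / kappa + 1.
  have : enorm d <= `|g2| / kappa.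
    by rewrite ler_pdivlMr // mulrC (le_trans h3) // (le_trans gx2) // ler_norm.
  by lra.
have armijo t : 0 < t -> t <= tau0 ->
    phi (x + t *: d) <= phi x + sigma * t * dot (grad x) d.
  move=> t0 tt; have [tL tr] : t <= kappa * (1 - sigma) / L /\
      t <= r / 2 / (`|g2| / kappa + 1) by move: tt; rewrite le_min => /andP.
  rewrite ler_pdivlMr // in tL; rewrite ler_pdivlMr // in tr.
  have yr : enorm (x + t *: d - xb) < r.
    have := ler_enormD (x - xb) (t *: d); rewrite enormZ gtr0_norm // addrAC.
    have : t * enorm d < t * (`|g2| / kappa + 1) by rewrite ltr_pM2l.
    by lra.
  have := descent_le L0 gphi GL xr yr.
  rewrite [x + _ - x]addrC addKr dotZl !dotZr -sqr_enorm => dl.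
  have e1 : t * L * enorm d ^+ 2 <= kappa * (1 - sigma) * enorm d ^+ 2.
    by rewrite ler_wpM2r ?sqr_ge0.
  have e2 : (1 - sigma) * (kappa * enorm d ^+ 2) <= (1 - sigma) * - dot (grad x) d.
    by rewrite ler_wpM2l // subr_ge0 ltW.
  have e3 : t * (t * L * enorm d ^+ 2) <= t * ((1 - sigma) * - dot (grad x) d).
    by rewrite ler_pM2l //; lra.
  by lra.
(* If [j > 0], the step [beta ^+ j.-1] was rejected and therefore exceeds [tau0]. *)
have tau1j : tau1 <= beta ^+ j.
  case: j jmin {le} => [_|i imin]; first by rewrite expr0 ge_min lexx.
  rewrite ge_min exprS ler_pM2l //; apply/orP; right; rewrite leNgt; apply/negP => lt.
  have := imin i (ltnSn i); rewrite ltNge armijo ?exprn_gt0 //; exact: ltW.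
apply: le_trans le _; rewrite lerD2l -[X in X <= _]opprK lerN2 -mulrN.
apply: ler_pM.
- by rewrite mulr_ge0 // ltW.
- by rewrite mulr_ge0 ?sqr_ge0 // ltW.
- by rewrite ler_wpM2l // ltW.
apply: le_trans h1; rewrite ler_wpM2l ?(ltW kappa0) // lerXn2r ?nnegrE ?enorm_ge0 //.
by rewrite divr_ge0 // ltW.
Qed.

End Ball.
End NewtonSteps.

(** * Convergence of the iterates to a stationary cluster point *)

Section Convergence.
Variables (R : realType) (n : nat) (phi : 'rV[R]_n -> R) (grad : 'rV[R]_n -> 'rV[R]_n).
Variables (sigma beta : R) (x0 : 'rV[R]_n) (xs : nat -> 'rV[R]_n).
Hypotheses (sigma0 : 0 < sigma) (sigma1 : sigma < 1) (beta0 : 0 < beta) (beta1 : beta < 1).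
Hypothesis phiC : C11 phi grad.
Hypothesis pd : forall x, phi x <= phi x0 ->
  forall u z, u != 0 -> hess2 grad x u z -> 0 < dot z u.
Hypothesis xsP : gdn_sequence phi grad sigma beta x0 xs.

Lemma gdn_level k : phi (xs k) <= phi x0.
Proof.
have [x00 step] := xsP; elim: k => [|k IH]; first by rewrite x00.
exact: le_trans (gdn_step_descent sigma0 beta0 (pd IH) (step k)) IH.
Qed.

Lemma gdn_decreasing k m : (k <= m)%N -> phi (xs m) <= phi (xs k).
Proof.
have [_ step] := xsP; elim: m => [|m IH]; first by rewrite leqn0 => /eqP ->.
rewrite leq_eqVlt => /orP[/eqP -> //|]; rewrite ltnS => /IH ih; apply: le_trans _ ih.
exact: (gdn_step_descent sigma0 beta0 (pd (gdn_level m)) (step m)).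
Qed.

Variable xb : 'rV[R]_n.
Hypothesis xb_cluster : forall e : R, 0 < e ->
  forall N, exists2 k, (N <= k)%N & enorm (xs k - xb) < e.

Lemma cluster_value_le k : phi xb <= phi (xs k).
Proof.
rewrite leNgt; apply/negP => lt; have [gphi _] := phiC.
have [|d d0 hd] := gradient_continuous (gphi xb) (e := phi xb - phi (xs k)).
  by rewrite subr_gt0.
have [m km /hd] := xb_cluster d0 k; rewrite ltr_norml => /andP[h _].
by have := gdn_decreasing km; lra.
Qed.

Let xb_pd := pd (le_trans (cluster_value_le 0) (gdn_level 0)).

Lemma cluster_stationary : grad xb = 0.
Proof.
apply/eqP; apply: contrapT => /negP g0.
have gp : 0 < enorm (grad xb) by rewrite enorm_gt0.
have [gphi _] := phiC; have [_ step] := xsP.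
have [r [kappa [L [[r0 kappa0 L0] GL _ coer]]]] := local_coercivity phiC xb_pd.
have [|Delta Delta0 dec] := armijo_decrease sigma0 sigma1 beta0 r0 kappa0 L0 gphi GL coer
  (enorm (grad xb) * 2) (g1 := enorm (grad xb) / 2); first exact: divr_gt0.
have [d d0 hd] := gradient_continuous (gphi xb) Delta0.
(* Closeness [e] puts [phi (xs k)] below [phi xb + Delta] and the gradient norm between 1/2 and 2
   times that at [xb]; the next iterate then falls below [phi xb]. *)
pose e : R := Num.min d (Num.min (r / 2) (enorm (grad xb) / 2 / L)).
have e0 : 0 < e by rewrite !lt_min d0 !divr_gt0.
have [k _] := xb_cluster e0 0; rewrite !lt_min => /and3P[/hd kd kr kg].
have kr' : enorm (xs k - xb) < r by lra.
have kL := GL _ _ kr' (_ : enorm (xb - xb) < r); rewrite subrr enorm0 in kL.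
move: kL => /(_ r0) kL; rewrite ltr_pdivlMr // in kg.
have n1 := ler_enormB (grad (xs k)) (grad (xs k) - grad xb); rewrite subKr in n1.
have n2 := ler_enormD (grad xb) (grad (xs k) - grad xb); rewrite subrKC in n2.
have := dec _ _ kr _ (step k) => /(_ ltac:(apply/andP; split; lra)).
by have := cluster_value_le k.+1; move: kd; rewrite ltr_norml => /andP[_ h]; lra.
Qed.

(* Near [xb] the values of [phi] control the distance to [xb] and decrease along the
   sequence, so an iterate close enough to [xb] traps all later ones. *)
Lemma cluster_limit : seq_cvg xs xb.
Proof.
move=> eps eps0; have gxb := cluster_stationary.
have [gphi _] := phiC; have [_ step] := xsP.
have [r [kappa [L [[r0 kappa0 L0] GL mono coer]]]] := local_coercivity phiC xb_pd.
have cr : enorm (xb - xb) < r by rewrite subrr enorm0.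
have q1 : 0 < 1 + L / kappa by rewrite ltr_wpDr // divr_ge0 // ltW.
(* A step from distance less than [e] has length at most [e L / kappa], so the next iterate stays in
   the ball of radius [r]. *)
pose e : R := Num.min eps (r / (1 + L / kappa)).
have e0 : 0 < e by rewrite lt_min eps0 divr_gt0.
have e_eps : e <= eps by rewrite ge_min lexx.
have er : e * (1 + L / kappa) <= r by rewrite -ler_pdivlMr // ge_min lexx orbT.
have Lk : 0 <= e * (L / kappa) by rewrite mulr_ge0 ?divr_ge0 // ltW.
(* This is the growth of [phi] forced at distance [e], so a point of the ball with smaller excess
   over [phi xb] is closer than [e]. *)
pose level : R := kappa / 4 * e ^+ 2.
have level0 : 0 < level by rewrite mulr_gt0 ?divr_gt0 ?exprn_gt0.
have [d d0 hd] := gradient_continuous (gphi xb) level0.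
have [N _] := xb_cluster (e := Num.min d e) ltac:(by rewrite lt_min d0) 0.
rewrite lt_min => /andP[/hd]; rewrite ltr_norml => /andP[_ Nlevel] Ne.
suff trap k : (N <= k)%N -> enorm (xs k - xb) < e /\ phi (xs k) - phi xb < level.
  by exists N => k /trap[ke _]; exact: lt_le_trans e_eps.
elim: k => [|k IH]; first by rewrite leqn0 => /eqP NE; rewrite NE in Ne Nlevel.
rewrite leq_eqVlt => /orP[/eqP <- //|]; rewrite ltnS => /IH[ke kl].
have kr : enorm (xs k - xb) < r by lra.
have kg := GL _ _ kr cr; rewrite gxb subr0 in kg.
have kd := gdn_step_dist beta0 beta1 kappa0 coer kr (step k).
have kd' : enorm (xs k.+1 - xs k) <= L / kappa * enorm (xs k - xb).
  by rewrite mulrAC ler_pdivlMr // mulrC (le_trans kd).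
have kd2 : L / kappa * enorm (xs k - xb) <= L / kappa * e.
  by rewrite ler_wpM2l ?divr_ge0 // ltW.
have k1r : enorm (xs k.+1 - xb) < r.
  by have := ler_dist_enormD (xs k.+1) (xs k) xb; lra.
have k1l : phi (xs k.+1) - phi xb < level.
  by have := gdn_decreasing (leqnSn k); lra.
split=> //; have := strongly_convex_ge kappa0 gphi mono cr k1r.
rewrite gxb dot0l add0r -sqr_enorm => /le_lt_trans/(_ k1l).
by rewrite /level ltr_pM2l ?divr_gt0 // ltr_pXn2r ?nnegrE ?enorm_ge0 // ltW.
Qed.

Lemma cluster_tilt_stable : tilt_stable phi xb.
Proof.
have [gphi _] := phiC.
have [r [kappa [L [[r0 kappa0 L0] GL mono _]]]] := local_coercivity phiC xb_pd.
exact: (tilt_stable_stationary r0 kappa0 L0 gphi GL mono cluster_stationary).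
Qed.

End Convergence.

Theorem theorem3p7 (R : realType) (n : nat) (phi : 'rV[R]_n -> R)
  (grad : 'rV[R]_n -> 'rV[R]_n) (x0 : 'rV[R]_n) (sigma beta : R) :
  C11 phi grad ->
  (forall x, phi x <= phi x0 ->
     forall u z, u != 0 -> hess2 grad x u z -> 0 < dot z u) ->
  (exists M : R, forall x, phi x <= phi x0 -> enorm x <= M) ->
  0 < sigma -> sigma < 1 / 2 -> 0 < beta -> beta < 1 ->
  forall xs : nat -> 'rV[R]_n, gdn_sequence phi grad sigma beta x0 xs ->
  exists xb : 'rV[R]_n, seq_cvg xs xb /\ tilt_stable phi xb.
Proof.
move=> phiC pd [M bM] sigma0 sigma2 beta0 beta1 xs xsP.
have sigma1 : sigma < 1 by lra.
have [k|xb xbc] := @enorm_cluster_point _ _ xs M.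
  exact: bM (gdn_level sigma0 beta0 pd xsP k).
exists xb; split.
  exact: (cluster_limit sigma0 sigma1 beta0 beta1 phiC pd xsP xbc).
exact: (cluster_tilt_stable sigma0 sigma1 beta0 phiC pd xsP xbc).
Qed.
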